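(* Let $p$ be an odd prime and $n\ge 1$. For each $i\ge 1$, $\gamma_i(W_n)^\phi=\mathfrak{L}_n^i$, the $i$-th Lie power of $\mathfrak{L}_n$.
   Context: Let $p$ be an odd prime and $n\ge 1$. For $1\le k\le n$ let $B_k=\mathrm{Fun}(\mathbb{F}_p^{k-1},\mathbb{F}_p)$ (additive group; $B_1=\mathbb{F}_p$), whose elements are identified with polynomials over $\mathbb{F}_p$ in $x_1,\dots,x_{k-1}$ with degree at most $p-1$ in each variable (products reduced by $x_i^p=x_i$). Write $f\Delta_k$ for $f$ regarded as an element of $B_k$; it acts on $\mathbb{F}_p^n$ as the permutation $x\mapsto x-f(x_1,\dots,x_{k-1})e_k$. $W_n$ is the subgroup of $\mathrm{Sym}(\mathbb{F}_p^n)$ generated by $B_1,\dots,B_n$ (a Sylow $p$-subgroup of $\mathrm{Sym}(p^n)$). $\gamma_1(W_n)=W_n$, $\gamma_{i+1}(W_n)=[\gamma_i(W_n),W_n]$. Let $\mathcal{B}$ be the set of power monomials $x^\Lambda\Delta_k$, $1\le k\le n$, with $x^\Lambda=x_1^{\lambda_1}\cdots x_{k-1}^{\lambda_{k-1}}$, $0\le\lambda_i\le p-1$. A subgroup $S\le W_n$ is saturated if $S=S_1\cdots S_n$ with $S_i\le B_i$ and, whenever $f\Delta_k\in S$, for each monomial $cx^\Lambda$ ($c\in\mathbb{F}_p^*$) of $f$ the element $x^\Lambda\Delta_k$ is in $S$. The terms $\gamma_i(W_n)$ are saturated. $\mathfrak{L}_n$ is the Lie algebra over $\mathbb{F}_p$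 with basis $\mathfrak{B}=\{x^\Lambda\partial_k \mid 1\le k\le n,\ x^\Lambda=x_1^{\lambda_1}\cdots x_{k-1}^{\lambda_{k-1}},\ 0\le\lambda_i\le p-1\}$, viewed as a subalgebra of the Witt algebra of derivations of the truncated polynomial ring $\mathbb{F}_p[x_1,\dots,x_n]/(x_1^p,\dots,x_n^p)$, with $[x^\Lambda\partial_k,x^\Theta\partial_j]=\partial_j(x^\Lambda)x^\Theta\partial_k-x^\Lambda\partial_k(x^\Theta)\partial_j$ (products of monomials in which some exponent reaches $p$ are zero). Its Lie powers are $\mathfrak{L}_n^1=\mathfrak{L}_n$, $\mathfrak{L}_n^{i+1}=[\mathfrak{L}_n^i,\mathfrak{L}_n]$. On power monomials the map $\phi$ is $\phi(x^\Lambda\Delta_k)=x^\Lambda\partial_k$. For a saturated subgroup $S$ of $W_n$, $S^\phi$ denotes the $\mathbb{F}_p$-span in $\mathfrak{L}_n$ of $\phi(S\cap\mathcal{B})$. *)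

(* Defs.v *)
From HB Require Import structures.
From mathcomp Require Import all_boot all_order all_algebra.
From mathcomp Require Import all_fingroup all_solvable.

Set Implicit Arguments.
Unset Strict Implicit.
Unset Printing Implicit Defensive.

Import GRing.Theory.
Local Open Scope ring_scope.

(* Indices k : 'I_n are 0-based: B_k is Fun(F_p^k, F_p), whose elements       *)
(* involve the k coordinates preceding the one with index k.                  *)

Section Defs.
Variables p n : nat.

Definition prefix (k : 'I_n) (x : 'rV['F_p]_n) : 'rV['F_p]_k :=
  \row_(i < k) x 0 (widen_ord (ltnW (ltn_ord k)) i).

Definition shift (k : 'I_n) (f : {ffun 'rV['F_p]_k -> 'F_p})
    (x : 'rV['F_p]_n) : 'rV['F_p]_n :=
  x - f (prefix k x) *: delta_mx 0 k.

Lemma shift_inj k f : injective (@shift k f).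
Proof.
move=> x y /rowP e.
have exy i : i != k -> x 0 i = y 0 i.
  by move=> ik; move: (e i); rewrite !mxE (negbTE ik) andbF !mulr0 !subr0.
have ep : prefix k x = prefix k y.
  apply/rowP=> i; rewrite !mxE; apply: exy.
  by rewrite -val_eqE /= neq_ltn ltn_ord.
apply/rowP=> i; have [->|/exy //] := eqVneq i k.
by move: (e k); rewrite !mxE ep => /addIr.
Qed.

Definition Delta (k : 'I_n) (f : {ffun 'rV['F_p]_k -> 'F_p}) :
  {perm 'rV['F_p]_n} := perm (@shift_inj k f).

Definition B (k : 'I_n) : {set {perm 'rV['F_p]_n}} :=
  [set Delta f | f : {ffun 'rV['F_p]_k -> 'F_p}].

Definition W : {group {perm 'rV['F_p]_n}} := <<\bigcup_(k < n) B k>>%G.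

(* The pair (k, Lambda) indexes both x^Lambda Delta_k and x^Lambda d_k.       *)
Definition pmon := {k : 'I_n & {ffun 'I_k -> 'I_p}}.

Definition mon_fun (k : nat) (L : {ffun 'I_k -> 'I_p}) :
    {ffun 'rV['F_p]_k -> 'F_p} :=
  [ffun y : 'rV['F_p]_k => \prod_(i < k) y 0 i ^+ L i].

Definition mon_Delta (a : pmon) : {perm 'rV['F_p]_n} :=
  Delta (mon_fun (tagged a)).

Lemma mon_Delta_inj : prime p -> injective mon_Delta.
Proof.
move=> pp [k L] [l M] eD.
have ev x : @shift k (mon_fun L) x = @shift l (mon_fun M) x.
  by move/permP/(_ x): eD; rewrite !permE.
have ekl : k = l.
  apply/eqP/negPn/negP => kl.
  have /rowP/(_ k) := ev (const_mx 1).
  rewrite !mxE !eqxx (negbTE kl) andbF !mulr0 !subr0 !ffunE big1 => [/eqP|i _].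
    by rewrite mulr1 -subr_eq0 addrAC subrr add0r oppr_eq0 oner_eq0.
  by rewrite !mxE expr1n.
subst l; congr (existT _ _ _).
have evy (y : 'rV['F_p]_k) : \prod_(i < k) y 0 i ^+ L i = \prod_(i < k) y 0 i ^+ M i.
  pose x : 'rV['F_p]_n := \row_i oapp (y 0) 0 (insub (i : nat)).
  have px : prefix k x = y.
    by apply/rowP=> i; rewrite !mxE /= valK.
  have /rowP/(_ k) := ev x.
  rewrite /shift px !mxE !eqxx !mulr1 => /addrI/oppr_inj.
  by rewrite !ffunE.
apply/ffunP=> i.
have evt (t : 'F_p) : t ^+ L i = t ^+ M i.
  have := evy (\row_j if j == i then t else 1).
  rewrite (bigD1 i) //= [X in _ = X -> _](bigD1 i) //= !mxE eqxx.
  by rewrite !big1 ?mulr1 // => j ji; rewrite mxE (negbTE ji) expr1n.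
apply/val_inj => /=.
have ltF (d : {poly 'F_p}) : (size d <= p)%N -> (forall t, d.[t] = 0) -> d = 0.
  move=> sd rd; apply/eqP/negPn/negP => nd.
  have rd' : all (root d) (enum 'F_p) by apply/allP=> t _; rewrite /root rd.
  have := max_poly_roots nd rd' (enum_uniq _).
  by rewrite -cardE card_Fp // ltnNge sd.
have d0 : 'X^(L i) - 'X^(M i) = 0 :> {poly 'F_p}.
  apply: ltF => [|t]; last by rewrite !hornerE evt subrr.
  by rewrite (leq_trans (size_polyD _ _)) // geq_max size_polyN !size_polyXn !ltn_ord.
have := congr1 (fun q : {poly 'F_p} => q`_(L i)) d0.
rewrite coefB !coefXn eqxx coef0; case: eqVneq => [//|_] /eqP.
by rewrite subr0 oner_eq0.
Qed.

(* F_p[x_1,...,x_n]/(x_1^p,...,x_n^p), as coefficient functions. *)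
Definition tpoly := {ffun {ffun 'I_n -> 'I_p} -> ('F_p)^o}.

(* Zero as soon as some exponent is at least p. *)
Definition tmon (e : 'I_n -> nat) : tpoly :=
  [ffun m : {ffun 'I_n -> 'I_p} => [forall i, m i == e i :> nat]%:R].

Definition tmul (f g : tpoly) : tpoly :=
  [ffun m : {ffun 'I_n -> 'I_p} =>
    \sum_(a : {ffun 'I_n -> 'I_p})
      \sum_(b : {ffun 'I_n -> 'I_p} | [forall i, (a i + b i)%N == m i])
         f a * g b].

Definition tder (j : 'I_n) (f : tpoly) : tpoly :=
  [ffun m : {ffun 'I_n -> 'I_p} =>
    \sum_(a : {ffun 'I_n -> 'I_p} |
             [forall i, a i == (m i + (i == j))%N :> nat]) (a j)%:R * f a].

Lemma tmonM (a b : 'I_n -> nat) :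
  tmul (tmon a) (tmon b) = tmon (fun i => a i + b i)%N.
Proof.
apply/ffunP=> m; rewrite !ffunE.
under eq_bigr => c _ do under eq_bigr => d _ do rewrite !ffunE -natrM mulnb.
case: (boolP [forall i, _ == (a i + b i)%N]) => [/forallP ab|nab]; last first.
  rewrite big1 // => c _; rewrite big1 // => d /forallP cd.
  case: forallP => //= ca; case: forallP => //= db.
  case/negP: nab; apply/forallP=> i.
  by rewrite -(eqP (cd i)) (eqP (ca i)) (eqP (db i)).
have la i : (a i < p)%N.
  by apply: leq_ltn_trans (ltn_ord (m i)); rewrite (eqP (ab i)) leq_addr.
have lb i : (b i < p)%N.
  by apply: leq_ltn_trans (ltn_ord (m i)); rewrite (eqP (ab i)) leq_addl.
pose c : {ffun 'I_n -> 'I_p} := [ffun i => Ordinal (la i)].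
pose d : {ffun 'I_n -> 'I_p} := [ffun i => Ordinal (lb i)].
have cP (c' : {ffun 'I_n -> 'I_p}) : [forall i, c' i == a i :> nat] = (c' == c).
  apply/forallP/eqP => [h|-> i]; last by rewrite ffunE.
  by apply/ffunP=> i; apply/val_inj; rewrite ffunE /= (eqP (h i)).
have dP (d' : {ffun 'I_n -> 'I_p}) : [forall i, d' i == b i :> nat] = (d' == d).
  apply/forallP/eqP => [h|-> i]; last by rewrite ffunE.
  by apply/ffunP=> i; apply/val_inj; rewrite ffunE /= (eqP (h i)).
rewrite (bigD1 c) //= [X in _ + X]big1 ?addr0 => [|c' /negbTE nc]; last first.
  by rewrite big1 // => d' _; rewrite cP nc.
rewrite (bigD1 d) /=; last by apply/forallP=> i; rewrite !ffunE /= eq_sym.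
rewrite cP dP !eqxx [X in _ + X]big1 ?addr0 // => d' /andP[_ /negbTE nd].
by rewrite dP nd andbF.
Qed.

Lemma tder_mon (j : 'I_n) (a : 'I_n -> nat) : (a j < p)%N ->
  tder j (tmon a) = (a j)%:R *: tmon (fun i => a i - (i == j))%N.
Proof.
move=> aj; apply/ffunP=> m; rewrite !ffunE.
case: (posnP (a j)) => [a0|a_gt0].
  rewrite a0 scale0r big1 // => b /forallP bm; rewrite !ffunE.
  case: forallP => [ba|_]; last by rewrite mulr0.
  by move: (eqP (ba j)) (eqP (bm j)); rewrite a0 eqxx addn1 => ->.
have eqm (b : {ffun 'I_n -> 'I_p}) : [forall i, b i == (m i + (i == j))%N :> nat] ->
    [forall i, b i == a i :> nat] = [forall i, m i == (a i - (i == j))%N :> nat].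
  move/forallP=> bm; apply: eq_forallb => i; move: (eqP (bm i)) => ->.
  case: (eqVneq i j) => [->|_] /=; last by rewrite addn0 subn0.
  by rewrite addn1 subn1 -{1}(prednK a_gt0) eqSS.
case: (boolP [forall i, m i == (a i - (i == j))%N :> nat]) => hm; last first.
  rewrite scaler0 big1 // => b hb.
  by rewrite ffunE (eqm b hb) (negbTE hm) mulr0.
have la i : (a i < p)%N.
  have := forallP hm i; case: (eqVneq i j) => [->|_] //=.
  by rewrite subn0 => /eqP <-; apply: ltn_ord.
pose c : {ffun 'I_n -> 'I_p} := [ffun i => Ordinal (la i)].
rewrite (big_pred1 c) => [|b].
  rewrite !ffunE /=.
  suff -> : [forall i, c i == a i :> nat] by [].
  by apply/forallP=> i; rewrite ffunE.
apply/forallP/eqP => [h|-> i].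
  apply/ffunP=> i; apply/val_inj; rewrite ffunE /=.
  by have := hm; rewrite -(eqm b) => [/forallP/(_ i)/eqP|]; last exact/forallP.
rewrite ffunE /= (eqP (forallP hm i)); case: (eqVneq i j) => [->|_] /=.
  by rewrite subnK.
by rewrite subn0 addn0.
Qed.

Lemma tmul0 f : tmul f 0 = 0.
Proof.
apply/ffunP=> m; rewrite !ffunE big1 // => a _; rewrite big1 // => b _.
by rewrite ffunE mulr0.
Qed.

Lemma tmul0r f : tmul 0 f = 0.
Proof.
apply/ffunP=> m; rewrite !ffunE big1 // => a _; rewrite big1 // => b _.
by rewrite ffunE mul0r.
Qed.

Lemma tder0 j : tder j 0 = 0.
Proof. by apply/ffunP=> m; rewrite !ffunE big1 // => a _; rewrite ffunE mulr0. Qed.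

(* D : witt stands for the derivation \sum_k D k * d_k. *)
Definition witt := {ffun 'I_n -> tpoly}.

Definition pder (k : 'I_n) (f : tpoly) : witt :=
  [ffun j => if j == k then f else 0].

(* The bilinear extension of                                                  *)
(*   [f d_k, g d_j] = d_j(f) g d_k - f d_k(g) d_j       (see bracket_pder)    *)
Definition bracket (D E : witt) : witt :=
  [ffun k => \sum_j (tmul (tder j (D k)) (E j) - tmul (D j) (tder j (E k)))].

Lemma bracket_pder (k j : 'I_n) (f g : tpoly) :
  bracket (pder k f) (pder j g)
  = pder k (tmul (tder j f) g) - pder j (tmul f (tder k g)).
Proof.
apply/ffunP=> m; rewrite !ffunE sumrB; congr (_ - _).
  rewrite (bigD1 j) //= [X in _ + X]big1 => [|i /negbTE ij].
    by rewrite addr0 !ffunE eqxx; case: eqP; rewrite ?tder0 ?tmul0r.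
  by rewrite !ffunE ij tmul0.
rewrite (bigD1 k) //= [X in _ + X]big1 => [|i /negbTE ij].
  by rewrite addr0 !ffunE eqxx; case: eqP; rewrite ?tder0 ?tmul0.
by rewrite !ffunE ij tmul0r.
Qed.

Definition expn_ext (k : nat) (L : {ffun 'I_k -> 'I_p}) (i : 'I_n) : nat :=
  if insub (i : nat) is Some j then L j else 0%N.

Definition mon_pder (a : pmon) : witt :=
  pder (tag a) (tmon (expn_ext (tagged a))).

Definition Lie : {vspace witt} := <<[seq mon_pder a | a : pmon]>>%VS.

Definition lie_prod (U V : {vspace witt}) : {vspace witt} :=
  <<[seq bracket u v | u <- enum U, v <- enum V]>>%VS.

(* Meaningful for i >= 1. *)
Definition lie_power (i : nat) : {vspace witt} :=
  iter i.-1 (fun U => lie_prod U Lie) Lie.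

(* phi sends mon_Delta a to mon_pder a, see mon_Delta_inj; phi_span S is the  *)
(* span of the image of S :&: [set mon_Delta a | a : pmon].                   *)
Definition phi_span (S : {set {perm 'rV['F_p]_n}}) : {vspace witt} :=
  <<[seq mon_pder a | a in [set a : pmon | mon_Delta a \in S]]>>%VS.

End Defs.

(* Main.v *)
Require Import Defs.
From mathcomp Require Import all_boot all_order all_algebra.
From mathcomp Require Import all_fingroup all_solvable all_field.
From mathcomp Require Import zify ring.

(** Give x_i the weight p^i, so that the weight of a reduced monomial x^L is the
  integer with base-p digits L: each variable outweighs every reduced monomial in
  the earlier ones, and the reduced monomials in x_0, ..., x_(k-1) have the
  weights 0, ..., p^k - 1, each once.  Both sides of the theorem turn out to be
  the span [layer i] of the x^L d_k with wt L + i <= p^k: in the row of index k,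
  a step of the lower central series or of the Lie powers removes exactly the
  heaviest remaining monomial.

  On the Lie side, differentiating by x_j lowers a weight by p^j and multiplying
  by a reduced monomial in the variables below x_j restores at most p^j - 1, so
  a bracket loses at least one ([bracket_layer]).  A loss of exactly one is
  achieved by choosing x_j according to the carry of wt L + 1 in base p ([carry])
  and multiplying by the full monomial below x_j ([bracket_borrow]).

  For the upper bound on the group side, let W act on all functions on F_p^n, and
  filter these by the spans [Vwt n d] of the monomials of weight less than d.  A
  generator replaces x_j by x_j - g with g a function of the coordinates below j,
  hence moves each monomial by lighter terms only.  So w - 1 lowers weights by at
  least 1 for w in W, and by at least i for w in the i-th term of the lower
  central series ([lcn_lowers]), since v w - w v = (v-1)(w-1) - (w-1)(v-1).
  Applied to the function x_k, of weight p^k, this bounds the weight of x^L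
  whenever x^L Delta_k lies in that term ([mon_Delta_lcn_le]).

  For the lower bound the substitution that performs the borrow is the action of
  a generator, so that x^L Delta_k is, up to a unit and to lighter terms, a
  commutator of the monomial one heavier ([Delta_full_borrow], [Delta_comm]);
  induction on the weight disposes of the lighter terms ([Delta_lcn]). *)

Set Implicit Arguments.
Unset Strict Implicit.
Unset Printing Implicit Defensive.

Import GRing.Theory.
Local Open Scope ring_scope.

(** * Spans, generated groups and splitting of products *)

Lemma ffunZ (I : finType) (K : pzRingType) (V : lmodType K) (c : K)
    (f : {ffun I -> V}) x : (c *: f) x = c *: f x.
Proof. by rewrite ffunE. Qed.

Lemma span_ind (K : fieldType) (vT : vectType K) (X : seq vT)
    (P : vT -> Prop) :
  P 0 -> (forall u v, P u -> P v -> P (u + v)) ->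
  (forall c v, P v -> P (c *: v)) -> (forall x, x \in X -> P x) ->
  forall v, v \in <<X>>%VS -> P v.
Proof.
move=> P0 PD PZ PX v vX; rewrite (coord_span (X := in_tuple X) vX).
apply: (big_ind P) => // i _; apply: PZ; apply: PX.
by rewrite mem_nth // size_tuple.
Qed.

Lemma span_linear (K : fieldType) (vT wT : vectType K) (f : vT -> wT)
    (X : seq vT) (U : {vspace wT}) :
  linear f -> (forall x, x \in X -> f x \in U) ->
  forall v, v \in <<X>>%VS -> f v \in U.
Proof.
move=> lin_f fX; have f0 : f 0 = 0.
  by have := lin_f (-1) 0 0; rewrite scaler0 addr0 scaleN1r addNr.
apply: span_ind => [|u v uU vU|c v vU|x /fX //]; first by rewrite f0 mem0v.
  by rewrite -[u]scale1r lin_f scale1r memvD.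
by rewrite -[c *: v]addr0 lin_f f0 addr0 memvZ.
Qed.

Lemma gen_ind (gT : finGroupType) (A : {set gT}) (P : gT -> Prop) :
  P 1%g -> (forall x y, P x -> P y -> P (x * y)%g) ->
  (forall x, x \in A -> P x) -> forall x, x \in <<A>>%g -> P x.
Proof.
move=> P1 PM PA x /gen_prodgP[m [c cA ->]].
by apply: (big_ind P) => // i _; apply: PA.
Qed.

Lemma big_split_at (R : Type) (idx : R) (op : Monoid.com_law idx) (m : nat)
    (j : 'I_m) (F : 'I_m -> R) :
  \big[op/idx]_(i < m) F i =
  op (\big[op/idx]_(i < j) F (widen_ord (ltnW (ltn_ord j)) i))
     (op (F j) (\big[op/idx]_(i < m | (j < i)%N) F i)).
Proof.
rewrite (bigID (fun i : 'I_m => i < j)%N) /= big_ord_narrow; first exact/ltnW.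
move=> le_jm; congr (op _ _); first by apply: eq_bigr => i _; congr F; apply: val_inj.
rewrite (bigD1 j) ?ltnn //=; congr (op _ _); apply: eq_bigl => i.
by rewrite -leqNgt -val_eqE /= [RHS]ltn_neqAle andbC eq_sym.
Qed.

(** * Linearity of the Lie bracket *)

Section Linearity.
Variables p n : nat.

Lemma tmul_linearl (h : tpoly p n) : linear (fun f => tmul f h).
Proof.
move=> c f g; apply/ffunP=> m; rewrite ffunE [RHS]ffunE ffunZ.
rewrite [tmul f h m]ffunE [tmul g h m]ffunE scaler_sumr -big_split /=.
apply: eq_bigr => a _; rewrite scaler_sumr -big_split /=; apply: eq_bigr => b _.
by rewrite ffunE ffunZ mulrDl scalerAl.
Qed.

Lemma tmul_linearr (h : tpoly p n) : linear (tmul h).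
Proof.
move=> c f g; apply/ffunP=> m; rewrite ffunE [RHS]ffunE ffunZ.
rewrite [tmul h f m]ffunE [tmul h g m]ffunE scaler_sumr -big_split /=.
apply: eq_bigr => a _; rewrite scaler_sumr -big_split /=; apply: eq_bigr => b _.
by rewrite ffunE ffunZ mulrDr scalerAr.
Qed.

Lemma tder_linear (j : 'I_n) : linear (@tder p n j).
Proof.
move=> c f g; apply/ffunP=> m; rewrite ffunE [RHS]ffunE ffunZ.
rewrite [tder j f m]ffunE [tder j g m]ffunE scaler_sumr -big_split /=.
apply: eq_bigr => a _.
by rewrite ffunE ffunZ mulrDr scalerAr.
Qed.

Lemma bracket_linearl (E : witt p n) : linear (fun D => bracket D E).
Proof.
move=> c D D'; apply/ffunP=> k; rewrite ffunE [RHS]ffunE ffunZ.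
rewrite [bracket D E k]ffunE [bracket D' E k]ffunE scaler_sumr -big_split /=.
apply: eq_bigr => j _.
rewrite ![(c *: D + _) _]ffunE !ffunZ.
by rewrite tder_linear !tmul_linearl scalerBr opprD addrACA.
Qed.

Lemma bracket_linearr (D : witt p n) : linear (bracket D).
Proof.
move=> c E E'; apply/ffunP=> k; rewrite ffunE [RHS]ffunE ffunZ.
rewrite [bracket D E k]ffunE [bracket D E' k]ffunE scaler_sumr -big_split /=.
apply: eq_bigr => j _.
rewrite ![(c *: E + _) _]ffunE !ffunZ.
by rewrite tder_linear !tmul_linearr scalerBr opprD addrACA.
Qed.

Lemma pderZ (k : 'I_n) c (f : tpoly p n) : pder k (c *: f) = c *: pder k f.
Proof.
by apply/ffunP=> j; rewrite !ffunE; case: eqP => // _; rewrite scaler0.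
Qed.

Lemma pder0 (k : 'I_n) : pder k (0 : tpoly p n) = 0.
Proof. by apply/ffunP=> j; rewrite !ffunE; case: eqP. Qed.

Lemma eq_tmon (e e' : 'I_n -> nat) : e =1 e' -> tmon p e = tmon p e'.
Proof.
by move=> ee'; apply/ffunP=> m; rewrite !ffunE; under eq_forallb do rewrite ee'.
Qed.

Lemma tmon_over (e : 'I_n -> nat) (i : 'I_n) : (p <= e i)%N -> tmon p e = 0.
Proof.
move=> le_pe; apply/ffunP=> m; rewrite !ffunE; case: forallP => // /(_ i)/eqP em.
by have := ltn_ord (m i); rewrite em ltnNge le_pe.
Qed.

End Linearity.

(** * Weights of exponent vectors *)

Section Weight.
Variable p : nat.
Hypothesis p_prime : prime p.

Definition wt m (L : {ffun 'I_m -> 'I_p}) : nat := (\sum_(i < m) L i * p ^ i)%N.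

Definition tail_wt m (j : 'I_m) (L : {ffun 'I_m -> 'I_p}) : nat :=
  (\sum_(i < m | j < i) L i * p ^ i)%N.

(** Coordinates at which e is at least p get a junk value. *)
Definition expo m (e : nat -> nat) : {ffun 'I_m -> 'I_p} :=
  [ffun i : 'I_m => insubd (Ordinal (prime_gt0 p_prime)) (e i)].

Lemma expoE m (e : nat -> nat) (i : 'I_m) : (e i < p)%N -> expo m e i = e i :> nat.
Proof. by move=> lt_e; rewrite ffunE insubdK. Qed.

Lemma sum_full_digits m : (\sum_(i < m) p.-1 * p ^ i)%N = (p ^ m).-1.
Proof. by rewrite predn_exp big_distrr. Qed.

Lemma wt_lt m (L : {ffun 'I_m -> 'I_p}) : (wt L < p ^ m)%N.
Proof.
rewrite -[ltnRHS]prednK ?expn_gt0 ?prime_gt0 // ltnS -sum_full_digits.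
by apply: leq_sum => i _; rewrite leq_mul2r -ltnS prednK ?prime_gt0 ?ltn_ord ?orbT.
Qed.

Lemma wt_split m (j : 'I_m) (L : {ffun 'I_m -> 'I_p}) :
  wt L = (\sum_(i < j) L (widen_ord (ltnW (ltn_ord j)) i) * p ^ i
          + (L j * p ^ j + tail_wt j L))%N.
Proof. by rewrite /wt (big_split_at _ j). Qed.

(** Exponents indexed by all of nat allow monomials in different numbers of
  variables to be compared. *)
Definition nexp m (L : {ffun 'I_m -> 'I_p}) (i : nat) : nat :=
  if insub i is Some j then L j else 0%N.

Lemma nexpE m (L : {ffun 'I_m -> 'I_p}) (i : 'I_m) : nexp L i = L i.
Proof. by rewrite /nexp valK. Qed.

Lemma nexp_out m (L : {ffun 'I_m -> 'I_p}) i : (m <= i)%N -> nexp L i = 0%N.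
Proof. by move=> le_mi; rewrite /nexp insubF // ltnNge le_mi. Qed.

Lemma nexp_lt m (L : {ffun 'I_m -> 'I_p}) i : (nexp L i < p)%N.
Proof. by rewrite /nexp; case: insubP => [j _ _|_]; rewrite ?ltn_ord ?prime_gt0. Qed.

Lemma sum_nexp m m' (L : {ffun 'I_m -> 'I_p}) : (m <= m')%N ->
  (\sum_(i < m') nexp L i * p ^ i)%N = wt L.
Proof.
move=> le_mm'; rewrite /wt; under [RHS]eq_bigr do rewrite -nexpE.
rewrite (big_ord_widen m' (fun i => nexp L i * p ^ i)%N le_mm') [RHS]big_mkcond.
by apply: eq_bigr => i _; case: ltnP => // le_mi; rewrite nexp_out.
Qed.

(** The exponent vector that results when x_j^a is multiplied by x^T and by the
  part of x^L above j, the shape of every term that a substitution for x_j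
  produces. *)
Definition graft m (j : 'I_m) (T : {ffun 'I_j -> 'I_p}) (a : nat)
    (L : {ffun 'I_m -> 'I_p}) : {ffun 'I_m -> 'I_p} :=
  expo m (fun i => if (i < j)%N then nexp T i
                   else if i == j then a else nexp L i).

Section Graft.
Variables (m : nat) (j : 'I_m) (T : {ffun 'I_j -> 'I_p}) (a : nat).
Variable L : {ffun 'I_m -> 'I_p}.
Hypothesis lt_ap : (a < p)%N.

Lemma graftE (i : 'I_m) : graft T a L i =
  (if (i < j)%N then nexp T i else if i == j then a else L i) :> nat.
Proof.
rewrite expoE -?val_eqE /= ?nexpE //.
by case: ifP => _; [apply: nexp_lt | case: ifP => // _; apply: ltn_ord].
Qed.

Lemma graft_below (i : 'I_j) :
  graft T a L (widen_ord (ltnW (ltn_ord j)) i) = T i :> nat.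
Proof. by rewrite graftE /= ltn_ord nexpE. Qed.

Lemma graft_at : graft T a L j = a :> nat.
Proof. by rewrite graftE ltnn eqxx. Qed.

Lemma graft_above (i : 'I_m) : (j < i)%N -> graft T a L i = L i :> nat.
Proof. by move=> lt_ji; rewrite graftE ltnNge ltnW //= -val_eqE gtn_eqF. Qed.

Lemma wt_graft : wt (graft T a L) = (wt T + (a * p ^ j + tail_wt j L))%N.
Proof.
rewrite (wt_split j) graft_at; congr (_ + (_ + _))%N.
  by apply: eq_bigr => i _; rewrite graft_below.
by apply: eq_bigr => i lt_ji; rewrite graft_above.
Qed.

End Graft.

Definition full_expo m : {ffun 'I_m -> 'I_p} := expo m (fun=> p.-1).
Definition zero_expo m : {ffun 'I_m -> 'I_p} := expo m (fun=> 0%N).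

Lemma full_expoE m (i : 'I_m) : full_expo m i = p.-1 :> nat.
Proof. by rewrite expoE // ltn_predL prime_gt0. Qed.

Lemma zero_expoE m (i : 'I_m) : zero_expo m i = 0%N :> nat.
Proof. by rewrite expoE // prime_gt0. Qed.

Lemma wt_full m : wt (full_expo m) = (p ^ m).-1.
Proof. by rewrite -sum_full_digits; apply: eq_bigr => i _; rewrite full_expoE. Qed.

Lemma wt_zero m : wt (zero_expo m) = 0%N.
Proof. by apply: big1 => i _; rewrite zero_expoE. Qed.

(** The carry in base p: the vector of weight wt L + 1 has a zero tail below
  some digit j, where L has a maximal tail.  Both the group and the Lie algebra
  go from the former monomial to the latter by one commutator. *)
Lemma carry m (L : {ffun 'I_m -> 'I_p}) : ((wt L).+1 < p ^ m)%N ->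
  exists j : 'I_m, [/\ ((L j).+1 < p)%N, L = graft (full_expo j) (L j) L
    & wt (graft (zero_expo j) (L j).+1 L) = (wt L).+1].
Proof.
move=> lt_wt; have [i0 lt_i0|full] := pickP (fun i : 'I_m => (L i).+1 < p)%N.
  case: (@arg_minnP _ i0 (fun i : 'I_m => (L i).+1 < p)%N
           (fun i : 'I_m => i : nat)) => // j lt_Lj min_j.
  have eL : L = graft (full_expo j) (L j) L.
    apply/ffunP=> i; apply/val_inj; rewrite /= graftE ?ltn_ord //.
    case: ifP => [lt_ij|_]; last by case: eqP => // ->.
    rewrite (nexpE (full_expo j) (Ordinal lt_ij)) full_expoE.
    have := ltn_ord (L i); case: (ltnP (L i).+1 p) => [/(min_j i)|]; lia.
  exists j; split=> //; rewrite [in RHS]eL !wt_graft ?ltn_ord // wt_full wt_zero.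
  by rewrite mulSn -addnA -addSn prednK ?expn_gt0 ?prime_gt0.
suff eL : wt L = (p ^ m).-1 by lia.
rewrite -sum_full_digits; apply: eq_bigr => i _; congr (_ * _)%N.
by have := full i; have := ltn_ord (L i); lia.
Qed.

(** * The uniserial filtration of the space of functions *)

Definition Fn m := {ffun 'rV['F_p]_m -> ('F_p)^o}.

Lemma FnZ m c (f : Fn m) x : (c *: f) x = c * f x.
Proof. by rewrite ffunE. Qed.

Definition mon m (L : {ffun 'I_m -> 'I_p}) : Fn m := mon_fun L.

Definition Vwt m (d : nat) : {vspace Fn m} :=
  <<[seq mon L | L in [set L : {ffun 'I_m -> 'I_p} | (wt L < d)%N]]>>%VS.

Lemma mon_Vwt m (L : {ffun 'I_m -> 'I_p}) d : (wt L < d)%N -> mon L \in Vwt m d.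
Proof. by move=> lt_Ld; apply: memv_span; apply: image_f; rewrite inE. Qed.

Lemma Vwt_ind m d (P : Fn m -> Prop) :
  P 0 -> (forall f g, P f -> P g -> P (f + g)) ->
  (forall c f, P f -> P (c *: f)) ->
  (forall L, (wt L < d)%N -> P (mon L)) -> forall f, f \in Vwt m d -> P f.
Proof.
move=> P0 PD PZ PL; apply: span_ind => // _ /imageP[L + ->].
by rewrite inE; apply: PL.
Qed.

Lemma Vwt_le m d d' : (d <= d')%N -> (Vwt m d <= Vwt m d')%VS.
Proof.
move=> le_dd'; apply/span_subvP=> _ /imageP[L + ->]; rewrite inE => lt_Ld.
exact/mon_Vwt/(leq_trans lt_Ld).
Qed.

(** By Fermat's little theorem this polynomial takes the value 1 at a and 0
  elsewhere. *)
Definition indic_poly (a : 'F_p) : {poly 'F_p} := 1 - ('X - a%:P) ^+ p.-1.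

Lemma indic_polyE (a t : 'F_p) :
  \sum_(l < p) (indic_poly a)`_l * t ^+ l = (t == a)%:R.
Proof.
have p_gt0 := prime_gt0 p_prime.
rewrite -horner_coef_wide; last first.
  apply: leq_trans (size_polyD _ _) _; rewrite size_poly1 size_polyN geq_max p_gt0.
  by rewrite size_exp_XsubC prednK /=.
rewrite /indic_poly !hornerE -[in RHS]subr_eq0.
have [->|nz] := eqVneq (t - a) 0.
  by rewrite expr0n -subn1 subn_eq0 leqNgt prime_gt1 //= subr0.
apply/eqP; rewrite subr_eq0 eq_sym -(inj_eq (mulfI nz)) mulr1 -exprS prednK //.
by rewrite -[X in _ ^+ X](card_Fp p_prime) expf_card.
Qed.

(** Every function on F_p^m is a combination of indicators of points, and an
  indicator is a product of one-variable polynomials of degree less than p. *)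
Lemma Vwt_full m : Vwt m (p ^ m) = fullv.
Proof.
apply/vspaceP=> f; rewrite memvf.
pose ind (y : 'rV['F_p]_m) : Fn m := [ffun x => (x == y)%:R].
have -> : f = \sum_y f y *: ind y.
  apply/ffunP=> x; rewrite sum_ffunE.
  under eq_bigr do rewrite FnZ ffunE.
  rewrite (bigD1 x) // eqxx mulr1 big1 => [|y]; first exact/esym/addr0.
  by rewrite eq_sym => /negbTE->; rewrite mulr0.
apply: memv_suml => y _; apply: memvZ.
suff -> : ind y = \sum_(L : {ffun 'I_m -> 'I_p})
    (\prod_i (indic_poly (y 0 i))`_(L i)) *: mon L.
  by apply: memv_suml => L _; apply/memvZ/mon_Vwt/wt_lt.
apply/ffunP=> x; rewrite sum_ffunE !ffunE.
under eq_bigr do rewrite !ffunE /GRing.scale /= -big_split /=.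
rewrite -(bigA_distr_bigA (fun i (l : 'I_p) => (indic_poly (y 0 i))`_l * x 0 i ^+ l)).
under eq_bigr do rewrite indic_polyE.
have [->|/eqP ne_xy] := eqVneq x y; first by rewrite big1 // => i _; rewrite eqxx.
have [/forallP eq_xy|/forallPn[i ne_i]] := boolP [forall i, x 0 i == y 0 i].
  by case: ne_xy; apply/rowP=> i; apply/eqP.
by rewrite (bigD1 i) //= (negbTE ne_i) mul0r.
Qed.

(** There are as many reduced monomials as the dimension of the space that they
  span. *)
Lemma mon_free m : free [seq mon L | L : {ffun 'I_m -> 'I_p}].
Proof.
apply: (@basis_free _ _ fullv); rewrite basisEdim -(Vwt_full m); apply/andP; split.
  by apply/span_subvP=> _ /imageP[L _ ->]; apply/memv_span/image_f.
rewrite Vwt_full dimvf size_image card_ffun !card_ord.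
have -> : dim (Fn m) = #|{: 'rV['F_p]_m}| by exact: muln1.
by rewrite card_mx card_Fp // mul1n.
Qed.

Lemma mon_Vwt_eq m (L : {ffun 'I_m -> 'I_p}) d : (mon L \in Vwt m d) = (wt L < d)%N.
Proof.
apply/idP/idP => [Ld|]; last exact: mon_Vwt.
rewrite ltnNge; apply/negP=> le_dL.
pose low (M : {ffun 'I_m -> 'I_p}) := (wt M < d)%N.
pose X := map (@mon m) (filter low (enum {:{ffun 'I_m -> 'I_p}})).
pose Y := map (@mon m) (filter (predC low) (enum {:{ffun 'I_m -> 'I_p}})).
have: free (X ++ Y).
  rewrite -map_cat (perm_free (perm_map _ (permEl (perm_filterC _ _)))).
  exact: mon_free.
rewrite cat_free => /and3P[_ freeY /directv_addP XY0].
have LY : mon L \in Y by rewrite map_f // mem_filter mem_enum /= -leqNgt le_dL.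
have LX : mon L \in <<X>>%VS.
  apply: subvP Ld; apply/span_subvP=> _ /imageP[M + ->]; rewrite inE => lt_Md.
  by apply/memv_span/map_f; rewrite mem_filter mem_enum /low lt_Md.
have : mon L \in (<<X>> :&: <<Y>>)%VS by rewrite memv_cap LX memv_span.
by rewrite XY0 memv0 (negbTE (free_not0 freeY LY)).
Qed.

(** * The action of the generators on functions *)

Definition act m (w : {perm 'rV['F_p]_m}) (f : Fn m) : Fn m := [ffun x => f (w x)].

Lemma act0 m (w : {perm 'rV['F_p]_m}) : act w 0 = 0.
Proof. by apply/ffunP=> x; rewrite !ffunE. Qed.

Lemma actD m (w : {perm 'rV['F_p]_m}) f g : act w (f + g) = act w f + act w g.
Proof. by apply/ffunP=> x; rewrite !ffunE. Qed.

Lemma actN m (w : {perm 'rV['F_p]_m}) f : act w (- f) = - act w f.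
Proof. by apply/ffunP=> x; rewrite !ffunE. Qed.

Lemma actZ m (w : {perm 'rV['F_p]_m}) c f : act w (c *: f) = c *: act w f.
Proof. by apply/ffunP=> x; rewrite !ffunE. Qed.

Lemma act1 m (f : Fn m) : act 1%g f = f.
Proof. by apply/ffunP=> x; rewrite !ffunE perm1. Qed.

Lemma actM m (v w : {perm 'rV['F_p]_m}) f : act (v * w)%g f = act v (act w f).
Proof. by apply/ffunP=> x; rewrite !ffunE permM. Qed.

Section Shift.
Variables (m : nat) (j : 'I_m).
Implicit Type g : {ffun 'rV['F_p]_j -> 'F_p}.

Lemma Delta_at g (x : 'rV['F_p]_m) : Delta g x 0 j = x 0 j - g (Defs.prefix j x).
Proof. by rewrite permE !mxE !eqxx mulr1. Qed.

Lemma Delta_off g (x : 'rV['F_p]_m) (i : 'I_m) : i != j -> Delta g x 0 i = x 0 i.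
Proof. by move=> /negbTE ne_ij; rewrite permE !mxE ne_ij andbF mulr0 subr0. Qed.

Lemma prefix_Delta g (x : 'rV['F_p]_m) (k : 'I_m) : (k <= j)%N ->
  Defs.prefix k (Delta g x) = Defs.prefix k x.
Proof.
move=> le_kj; apply/rowP=> i; rewrite !mxE Delta_off //.
by rewrite -val_eqE /= neq_ltn (leq_trans (ltn_ord i)).
Qed.

(** The shape of the terms that arise when x_j - g is substituted for x_j in a
  monomial. *)
Definition block g (a : nat) (L : {ffun 'I_m -> 'I_p}) : Fn m :=
  [ffun x => g (Defs.prefix j x) *
     (x 0 j ^+ a * \prod_(i < m | (j < i)%N) x 0 i ^+ L i)].

Definition low_mon (L : {ffun 'I_m -> 'I_p}) (y : 'rV['F_p]_j) : 'F_p :=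
  \prod_(i < j) y 0 i ^+ L (widen_ord (ltnW (ltn_ord j)) i).

Lemma block_mon T a L : (a < p)%N -> block (mon_fun T) a L = mon (graft T a L).
Proof.
move=> lt_ap; apply/ffunP=> x; rewrite !ffunE (big_split_at _ j) /=.
rewrite graft_at //; congr (_ * (_ * _)).
  by apply: eq_bigr => i _; rewrite mxE graft_below.
by apply: eq_bigr => i lt_ji; rewrite graft_above.
Qed.

(** No matter which function of the coordinates below j is present, it weighs
  less than x_j. *)
Lemma block_Vwt g a L : (a < p)%N ->
  block g a L \in Vwt m (a.+1 * p ^ j + tail_wt j L).
Proof.
move=> lt_ap; have : (g : Fn j) \in Vwt j (p ^ j) by rewrite Vwt_full memvf.
move: {g}(g : Fn j) => g0; elim/Vwt_ind: g0 / => [|f g fV gV|c f fV|T lt_T].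
- rewrite (_ : block _ _ _ = 0) ?mem0v //.
  by apply/ffunP=> x; rewrite !ffunE mul0r.
- rewrite (_ : block _ _ _ = block f a L + block g a L) ?memvD //.
  by apply/ffunP=> x; rewrite !ffunE mulrDl.
- rewrite (_ : block _ _ _ = c *: block f a L) ?memvZ //.
  by apply/ffunP=> x; rewrite !ffunE /GRing.scale /= mulrA.
rewrite /mon block_mon //; apply: mon_Vwt.
by rewrite wt_graft // mulSn -addnA ltn_add2r.
Qed.

(** The binomial expansion of the power of x_j - g. *)
Lemma act_Delta_mon g L : act (Delta g) (mon L) =
  \sum_(t < (L j).+1) 'C(L j, t)%:R *:
     block [ffun y => low_mon L y * (- g y) ^+ t] (L j - t) L.
Proof.
apply/ffunP=> x; rewrite sum_ffunE !ffunE (big_split_at _ j) /= Delta_at.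
under eq_bigr => i _.
  rewrite Delta_off; last by rewrite -val_eqE /= neq_ltn ltn_ord.
over.
under [X in _ * (_ * X)]eq_bigr => i lt_ji.
  rewrite Delta_off; last by rewrite -val_eqE /= neq_ltn lt_ji orbT.
over.
rewrite exprDn big_distrl big_distrr /=; apply: eq_bigr => t _.
rewrite !ffunE /GRing.scale /= /low_mon.
under [X in _ = _ * (X * _ * _)]eq_bigr do rewrite mxE.
by rewrite -mulr_natl; ring.
Qed.

(** The terms of order at least two in g have an x_j-exponent that is too small
  to matter, whatever g is. *)
Lemma act_Delta_first_order g L :
  act (Delta g) (mon L) - mon L
  + (L j)%:R *: block [ffun y => low_mon L y * g y] (L j).-1 L
  \in Vwt m ((L j).-1 * p ^ j + tail_wt j L).
Proof.
rewrite act_Delta_mon big_ord_recl /= bin0 scale1r subn0.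
have -> : block [ffun y => low_mon L y * (- g y) ^+ 0] (L j) L = mon L.
  apply/ffunP=> x; rewrite !ffunE (big_split_at _ j) /= mulr1 /low_mon.
  by congr (_ * _); apply: eq_bigr => i _; rewrite mxE.
rewrite [mon L + _]addrC addrK; have [->|Lj_gt0] := posnP (L j).
  by rewrite big_ord0 scale0r addr0 mem0v.
have lt_Lp := ltn_ord (L j); move: (nat_of_ord (L j)) Lj_gt0 lt_Lp => [//|l] _ lt_lp.
rewrite big_ord_recl /= bin1 /bump /= subn1 /=.
set b1 := block _ _ _; set b2 := block _ _ _.
have -> : b1 = - b2.
  by apply/ffunP=> x; rewrite !ffunE expr1; ring.
rewrite scalerN addrAC addNr add0r.
apply: memv_suml => t _; apply: memvZ; rewrite !add1n subSS.
have lt_t := ltn_ord t; set h := finfun _.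
apply: subvP (block_Vwt h L _); last by lia.
by apply: Vwt_le; rewrite leq_add2r leq_mul2r; apply/orP; right; lia.
Qed.

Lemma Delta_lowers_mon g L : act (Delta g) (mon L) - mon L \in Vwt m (wt L).
Proof.
have := act_Delta_first_order g L; set b := block _ _ _ => first_order.
rewrite -[_ - _](addrK ((L j)%:R *: b)) memvB //.
  apply: subvP first_order; apply/Vwt_le; rewrite (wt_split j).
  by rewrite addnA leq_add2r (leq_trans _ (leq_addl _ _)) // leq_mul2r leq_pred orbT.
have [->|Lj_gt0] := posnP (L j); first by rewrite scale0r mem0v.
apply: memvZ; have lt_Lj := ltn_ord (L j).
have /(subvP (Vwt_le _ _)) : b \in Vwt m ((L j).-1.+1 * p ^ j + tail_wt j L).
  by apply: block_Vwt; lia.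
by apply; rewrite prednK // (wt_split j) leq_addl.
Qed.

(** Substituting x_j - x_0^(p-1) ... x_(j-1)^(p-1) for x_j performs a borrow. *)
Lemma Delta_full_borrow (L : {ffun 'I_m -> 'I_p}) :
  L = graft (full_expo j) (L j) L -> ((L j).+1 < p)%N ->
  act (Delta (mon_fun (full_expo j))) (mon (graft (zero_expo j) (L j).+1 L))
  - mon (graft (zero_expo j) (L j).+1 L) + (L j).+1%:R *: mon L \in Vwt m (wt L).
Proof.
move=> eL lt_Lj; set M := graft (zero_expo j) _ _.
have eMj : M j = (L j).+1 :> nat by rewrite graft_at.
have := act_Delta_first_order (mon_fun (full_expo j)) M; rewrite eMj /=.
have -> : block [ffun y => low_mon M y * mon_fun (full_expo j) y] (L j) M = mon L.
  rewrite [in RHS]eL -block_mon //; apply/ffunP=> x; rewrite !ffunE.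
  congr (_ * (_ * _)); last first.
    by apply: eq_bigr => i lt_ji; rewrite graft_above.
  by rewrite /low_mon big1 ?mul1r // => i _; rewrite graft_below // zero_expoE.
apply: subvP; apply: Vwt_le; rewrite (wt_split j) -[leqLHS]add0n leq_add // leq_add2l.
rewrite leq_eqVlt; apply/orP; left; by apply/eqP/eq_bigr => i lt_ji; rewrite graft_above.
Qed.

End Shift.

Lemma Delta_lowers m (j : 'I_m) (g : {ffun 'rV['F_p]_j -> 'F_p}) d f :
  f \in Vwt m d -> act (Delta g) f - f \in Vwt m d.-1.
Proof.
move: f; apply: Vwt_ind => [|f h fV hV|c f fV|L lt_Ld].
- by rewrite act0 subr0 mem0v.
- by rewrite actD opprD addrACA memvD.
- by rewrite actZ -scalerBr memvZ.
by apply: subvP (Delta_lowers_mon g L); apply: Vwt_le; lia.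
Qed.

(** * The lower central series: upper bound *)

Section Group.
Variable n : nat.
Implicit Types v w : {perm 'rV['F_p]_n}.
Local Notation W := (W p n).

(** For d <= i the truncated subtraction gives Vwt n 0, the zero space, so that
  w fixes the functions in Vwt n d. *)
Definition lowers i w : Prop :=
  forall d f, f \in Vwt n d -> act w f - f \in Vwt n (d - i).

Lemma act_Vwt i w d f : lowers i w -> f \in Vwt n d -> act w f \in Vwt n d.
Proof.
move=> low_w fV; rewrite -[act w f](subrK f) memvD //.
exact/(subvP (Vwt_le n (leq_subr i d)))/low_w.
Qed.

Lemma lowers1 i : lowers i 1%g.
Proof. by move=> d f _; rewrite act1 subrr mem0v. Qed.

Lemma lowersM i v w : lowers i v -> lowers i w -> lowers i (v * w)%g.
Proof.
move=> low_v low_w d f fV; rewrite actM.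
have -> : act v (act w f) - f = act v (act w f - f) + (act v f - f).
  by rewrite actD actN addrA subrK.
by rewrite memvD ?low_v // (act_Vwt low_v) ?low_w.
Qed.

Lemma W_lowers w : w \in W -> lowers 1 w.
Proof.
move: w; apply: gen_ind => [|v w|w]; [exact: lowers1 | exact: lowersM |].
case/bigcupP=> k _ /imsetP[g _ ->] d f fV; rewrite subn1.
exact: Delta_lowers.
Qed.

(** On functions [v, w] - 1 is v^-1 w^-1 times the Lie commutator of v - 1
  and w - 1, hence it lowers weights by the sum of what v and w do. *)
Lemma lowersR i v w : v \in W -> lowers i v -> w \in W ->
  lowers i.+1 [~ v, w]%g.
Proof.
move=> vW low_v wW d f fV; have low_w := W_lowers wW.
have -> : act [~ v, w]%g f - f =
    act (v^-1 * w^-1)%g ((act v (act w f - f) - (act w f - f))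
                       - (act w (act v f - f) - (act v f - f))).
  have -> : act v (act w f - f) - (act w f - f) -
     (act w (act v f - f) - (act v f - f)) = act (v * w)%g f - act (w * v)%g f.
    by apply/ffunP=> x; rewrite !ffunE !permM; ring.
  by rewrite actD actN -!actM commgEl conjgE -invMg mulVg act1 invMg !mulgA.
apply: (@act_Vwt 1); first by apply: W_lowers; rewrite groupM ?groupV.
apply: memvB.
  by have := low_v _ _ (low_w _ _ fV); rewrite -subnDA.
by have := low_w _ _ (low_v _ _ fV); rewrite -subnDA addn1.
Qed.

Lemma lcn_lowers i w : w \in 'L_i.+1(W)%g -> lowers i.+1 w.
Proof.
elim: i w => [|i IHi] w; first by rewrite lcn1; apply: W_lowers.
rewrite lcnSn; move: w; apply: gen_ind => [|v w|w].
- exact: lowers1.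
- exact: lowersM.
case/imset2P=> u v uL vW ->; apply: lowersR => //; last exact: IHi.
by apply: subsetP uL; apply: lcn_sub.
Qed.

(** The coordinate function x_k has weight p^k, and x^L Delta_k subtracts the
  function x^L from it. *)
Lemma mon_Delta_lcn_le (a : pmon p n) i : mon_Delta a \in 'L_i.+1(W)%g ->
  (wt (tagged a) + i.+1 <= p ^ tag a)%N.
Proof.
case: a => k L /lcn_lowers low_D /=.
(* X is the exponent vector of x_k, and Ln pads L with zeros. *)
pose X := expo n (fun i => (i == k)%N : nat).
have eX (l : 'I_n) : X l = (l == k) :> nat.
  by rewrite expoE // (leq_ltn_trans (leq_b1 _)) ?prime_gt1.
pose Ln := expo n (nexp L).
have eLn (l : 'I_n) : Ln l = nexp L l :> nat by rewrite expoE ?nexp_lt.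
have wtX : wt X = (p ^ k)%N.
  rewrite /wt (bigD1 k) //= eX eqxx mul1n big1 ?addn0 // => l /negbTE ne_lk.
  by rewrite eX ne_lk.
have wtLn : wt Ln = wt L.
  by rewrite -(sum_nexp L (ltnW (ltn_ord k))); apply: eq_bigr => l _; rewrite eLn.
have XV : mon X \in Vwt n (p ^ k).+1 by rewrite mon_Vwt // wtX.
have monX x : mon X x = x 0 k.
  rewrite ffunE (bigD1 k) //= eX eqxx expr1 big1 ?mulr1 // => l /negbTE ne_lk.
  by rewrite eX ne_lk expr0.
have monLn x : mon Ln x = mon_fun L (Defs.prefix k x).
  rewrite !ffunE (big_split_at _ k) /= eLn nexp_out // expr0 mul1r.
  rewrite [X in _ * X]big1 ?mulr1 => [|l lt_kl]; last first.
    by rewrite eLn nexp_out // ltnW.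
  by apply: eq_bigr => l _; rewrite mxE eLn nexpE.
have := low_D _ _ XV.
have -> : act (mon_Delta (Tagged _ L)) (mon X) - mon X = - mon Ln.
  apply/ffunP=> x; rewrite ffunE [act _ _ x]ffunE [(- mon X) x]ffunE [RHS]ffunE.
  by rewrite !monX monLn Delta_at addrAC subrr add0r.
by rewrite memvN mon_Vwt_eq wtLn; lia.
Qed.

(** * The lower central series: lower bound *)

Lemma Delta0 (k : 'I_n) : @Delta p n k (0 : Fn k) = 1%g.
Proof. by apply/permP=> x; rewrite permE perm1 /shift ffunE scale0r subr0. Qed.

Lemma DeltaD (k : 'I_n) (f g : Fn k) :
  @Delta p n k (f + g) = (Delta f * Delta g)%g.
Proof.
apply/permP=> x; rewrite permM; apply/rowP=> i; have [->|ne_ik] := eqVneq i k.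
  by rewrite !Delta_at prefix_Delta // ffunE opprD addrA.
by rewrite !Delta_off.
Qed.

(** A scalar of F_p is a multiple of 1, so that scaling a function amounts to
  taking a power of the permutation. *)
Lemma Delta_Z_mem (G : {group {perm 'rV['F_p]_n}}) (k : 'I_n) c (f : Fn k) :
  Delta f \in G -> @Delta p n k (c *: f) \in G.
Proof.
move=> fG; rewrite -[c]natr_Zp scaler_nat; elim: (nat_of_ord c) => [|m IHm].
  by rewrite mulr0n Delta0 group1.
by rewrite mulrS DeltaD groupM.
Qed.

Definition widen_below (k : 'I_n) (j : 'I_k) : 'I_n :=
  widen_ord (ltnW (ltn_ord k)) j.

Lemma prefix_Delta_above (k : 'I_n) (j : 'I_k) (g : {ffun 'rV['F_p]_j -> 'F_p}) x :
  Defs.prefix k (@Delta p n (widen_below j) g x) = Delta g (Defs.prefix k x).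
Proof.
have pre_j : Defs.prefix (widen_below j) x = Defs.prefix j (Defs.prefix k x).
  by apply/rowP=> i; rewrite !mxE; congr (x _ _); apply: val_inj.
apply/rowP=> i; rewrite mxE; have [->|ne_ij] := eqVneq i j.
  by rewrite [RHS]Delta_at mxE Delta_at pre_j.
by rewrite [RHS]Delta_off // mxE Delta_off.
Qed.

(** Conjugation by a generator of smaller index acts on B_k through the action on
  functions; the inverse makes that action the substitution x_j - g and not
  x_j + g. *)
Lemma Delta_comm (k : 'I_n) (j : 'I_k) (f : Fn k) (g : {ffun 'rV['F_p]_j -> 'F_p}) :
  [~ Delta f, (@Delta p n (widen_below j) g)^-1]%g
  = @Delta p n k (act (Delta g) f - f).
Proof.
have pre_b := prefix_Delta_above g; set b := Delta _ in pre_b *.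
set D := Delta (_ - _).
suff eq_ba : (b * Delta f = Delta f * D * b)%g.
  by rewrite commgEl conjgE invgK [(b * _)%g]mulgA eq_ba -!mulgA mulKg mulgV mulg1.
have ne_jk : k != widen_below j by rewrite -val_eqE /= gtn_eqF.
apply/permP=> x; rewrite !permM; apply/rowP=> i; have [->|ne_ik] := eqVneq i k.
  rewrite Delta_at pre_b ![b _ _ k]Delta_off // !Delta_at prefix_Delta //.
  by rewrite !ffunE; ring.
rewrite Delta_off //; have [->|ne_ij] := eqVneq i (widen_below j).
  rewrite !Delta_at !Delta_off // 1?eq_sym //.
  by rewrite !prefix_Delta // ltnW /=.
by rewrite !Delta_off.
Qed.

(** Commutation with the inverse of the generator that performs the borrow leads
  from the monomial of weight d + 1 to the one of weight d, up to a unit factor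
  and lighter terms; the inner induction on d shows that the latter lie deep
  enough. *)
Lemma Delta_lcn (k : 'I_n) i d (f : Fn k) :
  f \in Vwt k d -> (d + i <= p ^ k)%N -> Delta f \in 'L_i.+1(W)%g.
Proof.
have DeltaW (l : 'I_n) (g : {ffun 'rV['F_p]_l -> 'F_p}) : Delta g \in W.
  by apply/mem_gen/bigcupP; exists l => //; apply: imset_f.
elim: i d f => [|i IHi] d f; first by rewrite lcn1.
elim: d f => [|d IHd] f fV le_d.
  suff -> : f = 0 by rewrite Delta0 group1.
  by move: f fV; apply: Vwt_ind => // [f g -> ->|c f ->]; rewrite ?addr0 ?scaler0.
move: f fV; apply: Vwt_ind => [|f g fL gL|c f fL|L lt_L].
- by rewrite Delta0 group1.
- by rewrite DeltaD groupM.
- exact: Delta_Z_mem.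
have [|wt_L] := ltnP (wt L) d.
  by move=> lt_Ld; apply: IHd; [apply: mon_Vwt | lia].
have {lt_L}wt_L : wt L = d by lia.
have [|j [lt_Lj eL wtM]] := @carry k L; first by lia.
have := Delta_full_borrow eL lt_Lj; set M := graft (zero_expo j) _ _ in wtM *.
set c := (L j).+1%:R; set r := _ + c *: _; rewrite wt_L => rV.
have nz_c : c != 0.
  by rewrite -(dvdn_pcharf (pchar_Fp p_prime)) gtnNdvd.
have -> : mon L = c^-1 *:
    (r + -1 *: (act (Delta (mon_fun (full_expo j))) (mon M) - mon M)).
  by rewrite /r scaleN1r addrC addKr scalerA mulVf ?scale1r.
apply: Delta_Z_mem; rewrite DeltaD groupM //; first by apply: IHd => //; lia.
apply: Delta_Z_mem; rewrite -Delta_comm /= lcnSn mem_commg ?groupV //.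
by apply: (IHi (wt M).+1); [apply: mon_Vwt | lia].
Qed.

Lemma mon_Delta_lcn (a : pmon p n) i :
  (mon_Delta a \in 'L_i.+1(W)%g) = (wt (tagged a) + i.+1 <= p ^ tag a)%N.
Proof.
apply/idP/idP => [|le_wt]; first exact: mon_Delta_lcn_le.
by apply: (@Delta_lcn (tag a) i (wt (tagged a)).+1 (mon (tagged a)));
  [apply: mon_Vwt | lia].
Qed.

End Group.

(** * The Lie powers *)

Section LiePower.
Variable n : nat.

Definition layer i : {vspace witt p n} :=
  <<[seq mon_pder a
    | a in [set a : pmon p n | (wt (tagged a) + i <= p ^ tag a)%N]]>>%VS.

Lemma mon_pder_layer (a : pmon p n) i :
  (wt (tagged a) + i <= p ^ tag a)%N -> mon_pder a \in layer i.
Proof. by move=> le_i; apply/memv_span/image_f; rewrite inE. Qed.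

(** Differentiating by x_j and multiplying by x^T replaces the weight p^j of
  x_j by the weight of x^T.  The hypothesis is symmetric in L and T because both
  halves of a bracket are of this form, with the roles exchanged. *)
Lemma tder_tmul_layer (k j : 'I_n) (L : {ffun 'I_k -> 'I_p})
    (T : {ffun 'I_j -> 'I_p}) i : (wt L + wt T + i <= p ^ k + p ^ j)%N ->
  pder k (tmul (tder j (tmon p (expn_ext L))) (tmon p (expn_ext T))) \in layer i.
Proof.
move=> le_wt.
rewrite tder_mon ?nexp_lt // -[_ *: _]addr0 tmul_linearl tmul0r addr0 pderZ.
have [->|] := posnP (expn_ext L j); first by rewrite scale0r mem0v.
rewrite -[expn_ext L j]/(nexp L j) => Lj_gt0; apply: memvZ; rewrite tmonM.
have lt_jk : (j < k)%N by rewrite ltnNge; apply/negP=> le_kj; rewrite nexp_out in Lj_gt0.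
pose e (l : nat) := (nexp L l - (l == j) + nexp T l)%N.
have [/forallP lt_ep|/forallPn[l]] := boolP [forall l : 'I_n, e l < p]%N; last first.
  by rewrite -leqNgt => /(tmon_over (e := e)) e0; rewrite [tmon _ _]e0 pder0 mem0v.
pose c : pmon p n := Tagged (fun k : 'I_n => {ffun 'I_k -> 'I_p}) (expo k e).
have lt_ek (l : 'I_k) : (e l < p)%N.
  exact: (lt_ep (widen_ord (ltnW (ltn_ord k)) l)).
suff -> : tmon p (fun l => expn_ext L l - (l == j) + expn_ext T l)%N =
          tmon p (expn_ext (tagged c)).
  apply: (mon_pder_layer (a := c)) => /=.
  suff : (wt (expo k e) + p ^ j = wt L + wt T)%N by lia.
  rewrite -(sum_nexp T (ltnW lt_jk)) -(sum_nexp L (leqnn k)) -big_split /=.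
  have -> : (p ^ j = \sum_(l < k) (l == j :> nat) * p ^ l)%N.
    rewrite (bigD1 (Ordinal lt_jk)) //= eqxx mul1n big1 ?addn0 // => l.
    by rewrite -val_eqE /= => /negbTE->.
  rewrite -big_split /=; apply: eq_bigr => l _; rewrite expoE // -!mulnDl.
  congr (_ * _)%N; rewrite /e; case: eqP => [->|_]; lia.
apply: eq_tmon => l; rewrite -[RHS]/(nexp (expo k e) l).
have [lt_lk|le_kl] := ltnP l k.
  by rewrite (nexpE (expo k e) (Ordinal lt_lk)) expoE.
rewrite -[expn_ext L l]/(nexp L l) -[expn_ext T l]/(nexp T l).
by rewrite !nexp_out // (leq_trans (ltnW lt_jk)).
Qed.

Lemma tmulC_mon (e e' : 'I_n -> nat) :
  tmul (tmon p e) (tmon p e') = tmul (tmon p e') (tmon p e).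
Proof. by rewrite !tmonM; apply: eq_tmon => l; rewrite addnC. Qed.

Lemma tmul_tderC (k : 'I_n) j (L : {ffun 'I_j -> 'I_p}) (e : 'I_n -> nat) :
  tmul (tmon p e) (tder k (tmon p (expn_ext L)))
  = tmul (tder k (tmon p (expn_ext L))) (tmon p e).
Proof.
rewrite tder_mon ?nexp_lt // -[_ *: _]addr0 tmul_linearl tmul_linearr.
by rewrite tmul0 tmul0r tmulC_mon.
Qed.

Lemma bracket_layer (a b : pmon p n) i : (wt (tagged a) + i <= p ^ tag a)%N ->
  bracket (mon_pder a) (mon_pder b) \in layer i.+1.
Proof.
case: a b => [k L] [j T] /= le_i; rewrite bracket_pder tmul_tderC.
by have lt_T := wt_lt T; apply: memvB; apply: tder_tmul_layer => /=; lia.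
Qed.

(** Differentiation by x_j undoes one step of x_j and multiplication by the full
  monomial below x_j fills the digits: the borrow, with no error term here. *)
Lemma bracket_borrow (k : 'I_n) (j : 'I_k) (L : {ffun 'I_k -> 'I_p}) :
  L = graft (full_expo j) (L j) L -> ((L j).+1 < p)%N ->
  bracket (pder k (tmon p (expn_ext (graft (zero_expo j) (L j).+1 L))))
          (pder (widen_below j) (tmon p (expn_ext (full_expo j))))
  = (L j).+1%:R *: pder k (tmon p (expn_ext L)).
Proof.
move=> eL lt_Lj; set M := graft _ _ _; set F := full_expo j.
have F0 l : (j <= l)%N -> nexp F l = 0%N by apply: nexp_out.
rewrite bracket_pder !tder_mon ?nexp_lt //.
rewrite -[expn_ext F k]/(nexp F k) F0 1?ltnW // scale0r tmul0 pder0 subr0.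
rewrite -[_ *: tmon _ _]addr0 tmul_linearl tmul0r addr0 pderZ.
have -> : expn_ext M (widen_below j) = (L j).+1.
  by rewrite -[LHS]/(nexp M j) nexpE graft_at.
rewrite tmonM; congr (_ *: pder k _); apply: eq_tmon => l.
rewrite -[LHS]/(nexp M l - (l == widen_below j) + nexp F l)%N -[RHS]/(nexp L l).
have [lt_lk|le_kl] := ltnP l k; last first.
  by rewrite !nexp_out // (leq_trans _ le_kl) // ltnW.
rewrite (nexpE M (Ordinal lt_lk)) (nexpE L (Ordinal lt_lk)) [in RHS]eL !graftE //.
rewrite -!val_eqE /=; have [lt_lj|lt_jl|eq_lj] := ltngtP l j.
- by rewrite (nexpE _ (Ordinal lt_lj)) zero_expoE.
- by rewrite F0 1?ltnW // subn0 addn0.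
- by rewrite F0 ?eq_lj // subn1 addn0.
Qed.

Lemma lie_prod_layer i : (0 < i)%N -> lie_prod (layer i) (Lie p n) = layer i.+1.
Proof.
move=> i_gt0; apply/vspaceP=> w; apply/idP/idP; apply/subvP: w; apply/span_subvP => w.
  case/allpairsP=> -[u v] [/=]; rewrite !mem_enum => uV vV ->.
  move: v vV; apply: (span_linear (bracket_linearr u)) => _ /imageP[b _ ->].
  move: u uV; apply: (span_linear (bracket_linearl _)) => _ /imageP[a + ->].
  by rewrite inE; apply: bracket_layer.
case/imageP=> -[k L]; rewrite inE /= => le_i ->.
have [|j [lt_Lj eL wtM]] := @carry k L; first by lia.
have nz_c : (L j).+1%:R != 0 :> 'F_p.
  by rewrite -(dvdn_pcharf (pchar_Fp p_prime)) gtnNdvd.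
have := bracket_borrow eL lt_Lj; set M := graft _ _ _ in wtM *.
move/esym/(canRL (scalerK nz_c)) => eq_L; rewrite /mon_pder /= eq_L.
apply/memvZ/memv_span/allpairsP.
exists (mon_pder (Tagged (fun k : 'I_n => {ffun 'I_k -> 'I_p}) M),
        mon_pder (Tagged (fun k : 'I_n => {ffun 'I_k -> 'I_p})
                         (full_expo j : {ffun 'I_(widen_below j) -> 'I_p}))).
split=> //=; rewrite mem_enum.
  by apply: mon_pder_layer => /=; lia.
exact/memv_span/image_f.
Qed.

Lemma lie_power_layer i : lie_power p n i.+1 = layer i.+1.
Proof.
elim: i => [|i IHi]; last by rewrite -lie_prod_layer // -IHi.
apply/vspaceP=> w; apply/idP/idP; apply/subvP: w; apply/span_subvP => _ /imageP[a _ ->].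
  by apply: mon_pder_layer; rewrite addn1 wt_lt.
exact/memv_span/image_f.
Qed.

Lemma phi_span_lcn i : phi_span ('L_i.+1(W p n))%g = layer i.+1.
Proof.
congr <<_>>%VS; apply: eq_image => [a|//]; rewrite !inE; exact: mon_Delta_lcn.
Qed.

End LiePower.

End Weight.

(** * The lower central series and the Lie powers *)

Theorem corollary5p4 (p n i : nat) (p_prime : prime p) (p_odd : odd p)
    (n_gt0 : (0 < n)%N) (i_gt0 : (0 < i)%N) :
  phi_span ('L_i(W p n))%g = lie_power p n i.
Proof.
case: i i_gt0 => [//|i] _; rewrite (phi_span_lcn p_prime).
by rewrite (lie_power_layer p_prime).
Qed.
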